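(* Let $n\ge 1$, $\epsilon>0$, and consider, on $\{(x,t): x\in\mathbb{R}^n\setminus\{0\},\ t>0\}$, the system $$u_t+(u\cdot\nabla)u=\frac{\epsilon}{2}\Delta u,\qquad \rho_t+\nabla\cdot(\rho u)=0 ,$$ for $u=(u_1,\dots,u_n)$ and scalar $\rho$. Let $q,\rho$ be smooth functions of $(r,t)$, $r>0,\ t>0$, and put $$u(x,t)=\frac{x}{r}\,q(r,t),\qquad \rho(x,t)=\rho(r,t),\qquad r=|x|.$$ (i) $(u,\rho)$ solves the system $u_t+(u\cdot\nabla)u=\frac{\epsilon}{2}\Delta u$, $\rho_t+\nabla\cdot(\rho u)=0$ on $\{(x,t): x\in\mathbb{R}^n\setminus\{0\},\ t>0\}$ if and only if $(q,\rho)$ satisfies $$q_t+qq_r=\frac{\epsilon}{2}\Big[q_{rr}+\frac{n-1}{r}q_r-\frac{n-1}{r^2}q\Big],\qquad \rho_t+r^{-(n-1)}\big(r^{n-1}\rho q\big)_r=0,\qquad r>0,\ t>0. \quad ( * )$$ (ii) The system $( * )$ is linearized by the transformation $$q(r,t)=-\epsilon\,\frac{a_r}{a},\qquad \rho(r,t)=r^{-(n-1)}p(r,t),$$ that is: if $a$ (smooth, positive) and $p$ (smooth) satisfy, for $r>0$, $t>0$, $$a_t=\frac{\epsilon}{2}\Big[a_{rr}+\frac{n-1}{r}a_r\Big],\qquad p_t+(pq)_r=0\quad\text{with } q=-\epsilon\frac{a_r}{a},$$ then $q=-\epsilon a_r/a$ and $\rho=r^{-(n-1)}p$ satisfy $(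 * )$.
   Context: Here $(u\cdot\nabla)u$ is the vector with $j$-th component $\sum_{k=1}^n u_k\,\partial_{x_k}u_j$, $\Delta$ acts componentwise, and subscripts $t,r$ denote partial derivatives. *)

(* Defs.v *)
From HB Require Import structures.
From mathcomp Require Import all_boot all_order all_algebra.
From mathcomp Require Import all_classical all_reals all_analysis.

Set Implicit Arguments.
Unset Strict Implicit.
Unset Printing Implicit Defensive.

Import Order.TTheory GRing.Theory Num.Theory.
Import numFieldNormedType.Exports.

Local Open Scope ring_scope.
Local Open Scope classical_set_scope.

(* Functions on an open domain are represented by total functions, and only
   their values on the domain matter: derivatives at a point of an open set
   are local. *)

Section HalfLine.
Context {R : realType}.
Implicit Types f g : R -> R -> R.

Definition dr f : R -> R -> R := fun r t => derive1 (fun s => f s t) r.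

Definition dt f : R -> R -> R := fun r t => derive1 (fun s => f r s) t.

(* All partial derivatives (in any order, mixed ones included) of order at
   most k exist and are jointly continuous on r > 0, t > 0. *)
Fixpoint Ck (k : nat) f : Prop :=
  (forall r t, 0 < r -> 0 < t ->
     {for (r, t), continuous (fun z : R * R => f z.1 z.2)}) /\
  match k with
  | 0%N => True
  | k'.+1 =>
      [/\ forall r t, 0 < r -> 0 < t ->
            derivable (fun s => f s t) r 1 /\ derivable (fun s => f r s) t 1,
          Ck k' (dr f) & Ck k' (dt f)]
  end.

Definition smooth f : Prop := forall k, Ck k f.

(* In the solution predicates below, the existence of the derivatives that
   occur is part of the definition, because 'D_v and derive1 are total. *)

Definition radial_system (n : nat) (eps : R) (q rho : R -> R -> R) : Prop :=
  forall r t, 0 < r -> 0 < t ->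
    let flux := fun s t => s ^+ n.-1 * rho s t * q s t in
    [/\ [/\ derivable (fun s => q r s) t 1,
            forall s, 0 < s -> derivable (fun s => q s t) s 1
          & derivable (fun s => dr q s t) r 1],
        dt q r t + q r t * dr q r t =
          eps / 2 * (dr (dr q) r t + (n%:R - 1) / r * dr q r t
                     - (n%:R - 1) / r ^+ 2 * q r t),
        derivable (fun s => rho r s) t 1 /\ derivable (fun s => flux s t) r 1
      & dt rho r t + r ^- n.-1 * dr flux r t = 0].

Definition radial_heat (n : nat) (eps : R) (a : R -> R -> R) : Prop :=
  forall r t, 0 < r -> 0 < t ->
    dt a r t = eps / 2 * (dr (dr a) r t + (n%:R - 1) / r * dr a r t).

Definition transport (p q : R -> R -> R) : Prop :=
  forall r t, 0 < r -> 0 < t ->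
    dt p r t + dr (fun s t => p s t * q s t) r t = 0.

End HalfLine.

Section Space.
Context {R : realType} {n : nat}.

(* The library norm on 'rV[R]_n is the sup norm. *)
Definition enorm (x : 'rV[R]_n) : R := Num.sqrt (\sum_(k < n) x 0 k ^+ 2).

Definition evec (k : 'I_n) : 'rV[R]_n := delta_mx 0 k.

Definition dx (k : 'I_n) (f : 'rV[R]_n -> R) : 'rV[R]_n -> R :=
  fun x => 'D_(evec k) f x.

Definition laplacian (f : 'rV[R]_n -> R) : 'rV[R]_n -> R :=
  fun x => \sum_(k < n) dx k (dx k f) x.

Definition divergence (v : 'rV[R]_n -> 'rV[R]_n) : 'rV[R]_n -> R :=
  fun x => \sum_(k < n) dx k (fun y => v y 0 k) x.

Definition advection (v : 'rV[R]_n -> 'rV[R]_n) (x : 'rV[R]_n) : 'rV[R]_n :=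
  \row_j \sum_(k < n) v x 0 k * dx k (fun y => v y 0 j) x.

Definition vlaplacian (v : 'rV[R]_n -> 'rV[R]_n) (x : 'rV[R]_n) : 'rV[R]_n :=
  \row_j laplacian (fun y => v y 0 j) x.

Definition vdt (u : 'rV[R]_n -> R -> 'rV[R]_n) (x : 'rV[R]_n) (t : R) :
    'rV[R]_n :=
  \row_j derive1 (fun s => u x s 0 j) t.

Definition burgers_system (eps : R) (u : 'rV[R]_n -> R -> 'rV[R]_n)
    (rho : 'rV[R]_n -> R -> R) : Prop :=
  forall (x : 'rV[R]_n) (t : R), x != 0 -> 0 < t ->
    [/\ forall j : 'I_n, derivable (fun s => u x s 0 j) t 1 /\
          (forall k : 'I_n,
             (forall y, y != 0 -> derivable (fun z => u z t 0 j) y (evec k)) /\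
             derivable (dx k (fun z => u z t 0 j)) x (evec k)),
        vdt u x t + advection (u ^~ t) x
          = (eps / 2) *: vlaplacian (u ^~ t) x,
        derivable (fun s => rho x s) t 1 /\
          (forall k : 'I_n,
             derivable (fun y => rho y t * u y t 0 k) x (evec k))
      & derive1 (fun s => rho x s) t
          + divergence (fun y => rho y t *: u y t) x = 0].

Definition radial_velocity (q : R -> R -> R) : 'rV[R]_n -> R -> 'rV[R]_n :=
  fun x t => q (enorm x) t *: ((enorm x)^-1 *: x).

Definition radial_density (rho : R -> R -> R) : 'rV[R]_n -> R -> R :=
  fun x t => rho (enorm x) t.

End Space.

Definition hopf_cole_velocity {R : realType} (eps : R) (a : R -> R -> R) :
    R -> R -> R :=
  fun r t => - eps * (dr a r t / a r t).

Definition hopf_cole_density {R : realType} (n : nat) (p : R -> R -> R) :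
    R -> R -> R :=
  fun r t => r ^- n.-1 * p r t.

(* Main.v *)
(* Writing u = g(|x|) x with g = q / r and h = g' / r, the chain rule
   d_k |x| = x_k / |x| gives d_k u_j = h x_k x_j + g delta_jk and
   Delta u_j = (r h' + (n + 2) h) x_j, so every term of the velocity equation
   is a radial multiple of x: it holds iff the multipliers agree, which after
   multiplication by r is the scalar equation for q.  The divergence of
   m(|x|) x is r m' + n m, which is r^(1-n) (r^n m)' for m = rho g.
   For the linearization, differentiating the heat equation in r and using
   a_rt = a_tr expresses q_t through r-derivatives of a only; the equation for
   q is then a rational identity in a, a_r, a_rr, a_rrr. *)
Require Import Defs.
From mathcomp Require Import all_boot all_order all_algebra.
From mathcomp Require Import all_classical all_reals all_analysis.
From mathcomp Require Import ring lra.

Set Implicit Arguments.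
Unset Strict Implicit.

Import Order.TTheory GRing.Theory Num.Theory.
Import numFieldNormedType.Exports.

Local Open Scope ring_scope.

(** * Differentiation rules for real-valued functions, along directions and on the line *)

Section DirectionalDerivatives.
Context {R : realType} {V : normedModType R}.
Implicit Types (f g : V -> R) (x v : V).

(** The difference quotients on the two sides are the same function of [h]. This carries
    one-variable rules over to directional derivatives. *)
Lemma is_derive_line f x v (d : R) :
  is_derive x v f d <-> is_derive (0 : R) 1 (fun h => f (h *: v + x)) d.
Proof.
have E : 'D_v f x = 'D_1 (fun h : R => f (h *: v + x)) 0.
  rewrite /derive; set g1 := fun h => h^-1 *: _; set g2 := fun h => h^-1 *: _.
  suff -> : g1 = g2 by [].
  by apply/funext => h /=; rewrite /g1 /g2/= addr0 scale0r add0r [_%:A]mulr1.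
split=> -[fxv <-].
  by split; [exact: (derivable1P f x v).1|rewrite E].
by split; [exact: (derivable1P f x v).2|rewrite E].
Qed.

(** Restricting [f] to the line through [x] along [v] leaves the one-variable chain rule, so a
    derivative of [f] in the single direction [v] is enough. *)
Lemma is_derive_comp_real f (g : R -> R) x v (a b : R) :
  is_derive x v f a -> is_derive (f x) 1 g b ->
  is_derive x v (fun y => g (f y)) (b * a).
Proof.
move=> /is_derive_line fa gb; apply/is_derive_line.
by apply: (@is_derive1_comp _ g (fun h => f (h *: v + x))); rewrite ?scale0r ?add0r.
Qed.

(** The product rule with ring multiplication in place of scaling, so that the resulting derivatives
    can be normalized by [ring] and [field]. *)
Lemma is_derive_mul f g x v (a b : R) :
  is_derive x v f a -> is_derive x v g b ->
  is_derive x v (fun y => f y * g y) (a * g x + f x * b).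
Proof.
move=> fa gb; have := is_deriveM fa gb.
by rewrite /GRing.scale /= addrC [_ * a]mulrC.
Qed.

Lemma is_derive_add f g x v (a b : R) :
  is_derive x v f a -> is_derive x v g b ->
  is_derive x v (fun y => f y + g y) (a + b).
Proof. exact: is_deriveD. Qed.

Lemma is_derive_sub f g x v (a b : R) :
  is_derive x v f a -> is_derive x v g b ->
  is_derive x v (fun y => f y - g y) (a - b).
Proof. exact: is_deriveB. Qed.

Lemma is_derive_scale (c : R) f x v (a : R) :
  is_derive x v f a -> is_derive x v (fun y => c * f y) (c * a).
Proof. exact: is_deriveZ. Qed.

End DirectionalDerivatives.

Lemma is_derive1_div {R : realType} (f g : R -> R) (x a b : R) :
  is_derive x 1 f a -> is_derive x 1 g b -> g x != 0 ->
  is_derive x 1 (fun y => f y / g y) (a / g x - f x * b / g x ^+ 2).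
Proof.
move=> fa gb gx0; rewrite (_ : _ - _ = a * (g x)^-1 + f x * (- (g x) ^- 2 *: b)).
  exact: is_derive_mul fa (is_deriveV gx0 gb).
by rewrite /GRing.scale /=; field.
Qed.

Lemma is_derive_derive1 {R : realType} (f : R -> R) (x d : R) :
  is_derive x 1 f d -> derive1 f x = d.
Proof. by move=> fd; rewrite derive1E derive_val. Qed.

(** The positive half-line is a neighbourhood of [r]. This allows differentiating identities that
    are known only for positive radii. *)
Lemma eq_pos_is_derive {R : realType} (f g : R -> R) (r d : R) : 0 < r ->
  (forall s, 0 < s -> f s = g s) -> is_derive r 1 f d -> is_derive r 1 g d.
Proof.
move=> r0 fg; apply: near_eq_is_derive; near=> s; apply: fg; near: s.
exact: lt_nbhsr.
Unshelve. all: by end_near. Qed.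

(** * Smooth functions of [(r, t)] and the symmetry of their mixed partials *)

Section HalfLineCalculus.
Context {R : realType}.
Implicit Types f : R -> R -> R.

Lemma smooth_dr f : smooth f -> smooth (dr f).
Proof. by move=> sf k; have [_ []] := sf k.+1. Qed.

Lemma smooth_dt f : smooth f -> smooth (dt f).
Proof. by move=> sf k; have [_ []] := sf k.+1. Qed.

Lemma smooth_continuous f (r t : R) : smooth f -> 0 < r -> 0 < t ->
  {for (r, t), continuous (fun z : R * R => f z.1 z.2)}.
Proof. by move=> sf r0 t0; have [+ _] := sf 0%N; exact. Qed.

Lemma smooth_is_derive_r f (r t : R) : smooth f -> 0 < r -> 0 < t ->
  is_derive r 1 (fun s => f s t) (dr f r t).
Proof.
move=> sf r0 t0; have [_ [/(_ r t r0 t0)[fr _] _ _]] := sf 1%N.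
by rewrite /dr derive1E; exact: derivableP.
Qed.

Lemma smooth_is_derive_t f (r t : R) : smooth f -> 0 < r -> 0 < t ->
  is_derive t 1 (fun s => f r s) (dt f r t).
Proof.
move=> sf r0 t0; have [_ [/(_ r t r0 t0)[_ ft] _ _]] := sf 1%N.
by rewrite /dt derive1E; exact: derivableP.
Qed.

(** The mean value theorem is used twice: in the first variable for the increment
    [f s (t + h) - f s t], then in the second variable for [dr f s]. *)
Lemma mixed_difference f (r t h : R) : 0 < h ->
  (forall s u, s \in `[r, r + h] -> u \in `[t, t + h] ->
     is_derive s 1 (f ^~ u) (dr f s u) /\
     is_derive u 1 (dr f s) (dt (dr f) s u)) ->
  exists s u, [/\ s \in `[r, r + h], u \in `[t, t + h] &
    f (r + h) (t + h) - f (r + h) t - (f r (t + h) - f r t) =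
      dt (dr f) s u * h * h].
Proof.
move=> h0 fd.
have rh : r < r + h by rewrite ltrDl.
have th : t < t + h by rewrite ltrDl.
have tin : t \in `[t, t + h] by rewrite in_itv/= lexx ltW.
have thin : t + h \in `[t, t + h] by rewrite in_itv/= lexx ltW.
have phid s : s \in `[r, r + h] ->
    is_derive s 1 (fun s => f s (t + h) - f s t) (dr f s (t + h) - dr f s t).
  move=> sI; apply: is_derive_sub.
    exact: (fd s _ sI thin).1.
  exact: (fd s _ sI tin).1.
have oo_cc a x : x \in `]a, a + h[ -> x \in `[a, a + h].
  by rewrite !in_itv/= => /andP[ax xh]; rewrite !ltW.
have [s sI E1] : exists2 s, s \in `[r, r + h] &
    f (r + h) (t + h) - f (r + h) t - (f r (t + h) - f r t) =
    (dr f s (t + h) - dr f s t) * (r + h - r).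
  have D s : s \in `]r, r + h[ -> is_derive s 1 (fun s => f s (t + h) - f s t)
      (dr f s (t + h) - dr f s t) by move=> /oo_cc; exact: phid.
  have [|s sI E] := MVT_segment (ltW rh) D; last by exists s.
  by apply: derivable_within_continuous => s sI; have [] := phid s sI.
have [u uI E2] : exists2 u, u \in `[t, t + h] &
    dr f s (t + h) - dr f s t = dt (dr f) s u * (t + h - t).
  have D u : u \in `]t, t + h[ -> is_derive u 1 (dr f s) (dt (dr f) s u).
    by move=> /oo_cc uI; exact: (fd s u sI uI).2.
  have [|u uI E] := MVT_segment (ltW th) D; last by exists u.
  by apply: derivable_within_continuous => u uI; have [_ []] := fd s u sI uI.
by exists s, u; split => //; rewrite E1 E2; ring.
Qed.

Lemma le_dist_of_close (e x y z z' : R) :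
  z = z' -> `|x - z| < e / 2 -> `|y - z'| < e / 2 -> `|x - y| <= e.
Proof.
move=> <- xz yz; rewrite -(subrKA z) (le_trans (ler_normD _ _))//.
by rewrite (splitr e) lerD// ltW// distrC.
Qed.

(* Both mixed partials are limits of the same second difference quotient. *)
Lemma dt_dr f (r t : R) : smooth f -> 0 < r -> 0 < t ->
  dt (dr f) r t = dr (dt f) r t.
Proof.
move=> sf r0 t0; apply/eqP; rewrite -subr_eq0 -normr_le0.
apply/ler_addgt0Pr => /= e e0; rewrite add0r.
have e2 : 0 < e / 2 by rewrite divr_gt0.
have /cvgrPdist_lt/(_ _ e2) c1 :=
  smooth_continuous (smooth_dt (smooth_dr sf)) r0 t0.
have /cvgrPdist_lt/(_ _ e2) c2 :=
  smooth_continuous (smooth_dr (smooth_dt sf)) r0 t0.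
have [d /= d0 dP] : exists2 d : R, 0 < d & forall s u, `|r - s| < d -> `|t - u| < d ->
   `|dt (dr f) r t - dt (dr f) s u| < e / 2 /\
   `|dr (dt f) r t - dr (dt f) s u| < e / 2.
  have N : nbhs (r, t) (fun z : R * R =>
      `|dt (dr f) r t - dt (dr f) z.1 z.2| < e / 2 /\
      `|dr (dt f) r t - dr (dt f) z.1 z.2| < e / 2).
    exact: filterI c1 c2.
  have [d /= d0 dP] := (nbhs_ballP _ _).1 N.
  by exists d => // s u rs tu; apply: (dP (s, u)).
(* Half of [d] keeps the closed intervals of length [h] strictly within distance [d] of [r] and
   [t]. *)
pose h := d / 2.
have h0 : 0 < h by rewrite divr_gt0.
have hd : h < d by rewrite /h; lra.
have near_in z s : s \in `[z, z + h] -> `|z - s| < d.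
  rewrite in_itv/= => /andP[zs sz]; rewrite distrC ger0_norm ?subr_ge0//; lra.
have pos z s : 0 < z -> s \in `[z, z + h] -> 0 < s.
  by move=> z0; rewrite in_itv/= => /andP[zs _]; exact: lt_le_trans zs.
have [|s [u [sI uI E1]]] := @mixed_difference f r t h h0.
  move=> s u sI uI; have s0 := pos _ _ r0 sI; have u0 := pos _ _ t0 uI.
  by split; [exact: smooth_is_derive_r|exact: smooth_is_derive_t (smooth_dr sf) _ _].
(* Exchanging the two variables of [f] yields the other mixed partial, at a possibly different
   intermediate point. *)
have [|u' [s' [uI' sI' E2]]] := @mixed_difference (fun u s => f s u) t r h h0.
  move=> u' s' uI' sI'; have s0 := pos _ _ r0 sI'; have u0 := pos _ _ t0 uI'.
  by split; [exact: smooth_is_derive_t|exact: smooth_is_derive_r (smooth_dt sf) _ _].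
have hN0 : h != 0 by rewrite gt_eqF.
(* Both second differences are the same combination of the four corner values of [f], so the factor
   [h * h] cancels. *)
have E : dt (dr f) s u = dr (dt f) s' u'.
  apply: (mulIf hN0); apply: (mulIf hN0).
  by apply: (etrans (esym E1)); apply: etrans E2; ring.
have [A _] := dP _ _ (near_in _ _ sI) (near_in _ _ uI).
have [_ B] := dP _ _ (near_in _ _ sI') (near_in _ _ uI').
exact: (le_dist_of_close E A B).
Qed.

End HalfLineCalculus.

(** * Radial functions and radial vector fields away from the origin *)

Section RadialFields.
Context {R : realType} {n : nat}.
Implicit Types (x y : 'rV[R]_n) (g h : R -> R).

Lemma enorm_sqr x : enorm x ^+ 2 = \sum_(k < n) x 0 k ^+ 2.
Proof. by rewrite sqr_sqrtr// sumr_ge0// => k _; rewrite sqr_ge0. Qed.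

Lemma enorm_gt0 x : x != 0 -> 0 < enorm x.
Proof.
move=> x0; rewrite lt0r sqrtr_ge0 andbT; apply: contra x0 => /eqP x0.
apply/eqP/rowP => k; rewrite mxE; apply/eqP; rewrite -sqrf_eq0.
have := enorm_sqr x; rewrite x0 expr0n/= => /esym/eqP.
rewrite psumr_eq0; last by move=> i _; rewrite sqr_ge0.
by move=> /allP/(_ k); rewrite mem_index_enum => /(_ isT).
Qed.

Lemma is_derive_coord x (k j : 'I_n) :
  is_derive x (evec k) (fun y => y 0 j) (j == k)%:R.
Proof.
apply/is_derive_line.
rewrite (_ : (fun _ => _) = (fun h : R => h * (j == k)%:R + x 0 j)).
  have := is_derive_add (is_derive_mul (is_derive_id (0 : R) (1 : R))
    (is_derive_cst ((j == k)%:R : R) (0 : R) (1 : R))) (is_derive_cst (x 0 j) (0 : R) (1 : R)).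
  by rewrite mul1r mulr0 !addr0.
by apply/funext => h; rewrite !mxE eqxx.
Qed.

Lemma is_derive_enorm x (k : 'I_n) : x != 0 ->
  is_derive x (evec k) enorm (x 0 k / enorm x).
Proof.
move=> x0; have r0 := enorm_gt0 x0.
have S : is_derive x (evec k) (fun y => \sum_(j < n) y 0 j ^+ 2) (2 * x 0 k).
  rewrite (_ : (fun _ => _) = \sum_(j < n) (fun y : 'rV[R]_n => y 0 j * y 0 j));
    last by apply/funext => y; rewrite fct_sumE; apply: eq_bigr.
  rewrite (_ : 2 * _ =
      \sum_(j < n) ((j == k)%:R * x 0 j + x 0 j * (j == k)%:R)).
    by apply: is_derive_sum => j; apply: is_derive_mul; exact: is_derive_coord.
  rewrite (bigD1 k)//= big1 => [|j /negbTE ->]; last by rewrite mul0r mulr0 addr0.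
  by rewrite eqxx /=; ring.
have s0 : 0 < \sum_(j < n) x 0 j ^+ 2 by rewrite -enorm_sqr exprn_gt0.
have := is_derive_comp_real S (is_derive1_sqrt s0).
(* The 2 from differentiating squares cancels the 2 in the derivative of the square root. *)
rewrite -/(enorm x) invfM mulrACA mulVf ?pnatr_eq0// mul1r.
by rewrite [_ * x 0 k]mulrC.
Qed.

Lemma is_derive_radial g (dg : R) x (k : 'I_n) : x != 0 ->
  is_derive (enorm x) 1 g dg ->
  is_derive x (evec k) (fun y => g (enorm y)) (dg * (x 0 k / enorm x)).
Proof. by move=> x0; apply: is_derive_comp_real; exact: is_derive_enorm. Qed.

(** A singleton is closed in a Hausdorff space. Second derivatives need this, since the formulas for
    first derivatives hold only off the origin. *)
Lemma near_neq0 x : x != 0 -> \forall y \near x, y != 0.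
Proof.
move=> x0; have O : open [set y : 'rV[R]_n | y != 0]%classic.
  rewrite (_ : mkset _ = ~` [set 0])%classic.
    apply: closed_openC; apply: accessible_closed_set1.
    exact/hausdorff_accessible/norm_hausdorff.
  by apply/seteqP; split=> y /= /eqP.
exact: (open_nbhs_nbhs (conj O x0)).
Qed.

Lemma is_derive_radial_coord g (dg : R) x (k j : 'I_n) : x != 0 ->
  is_derive (enorm x) 1 g dg ->
  is_derive x (evec k) (fun y => g (enorm y) * y 0 j)
    (dg / enorm x * (x 0 k * x 0 j) + g (enorm x) * (j == k)%:R).
Proof.
move=> x0 gd.
rewrite (_ : _ + _ = dg * (x 0 k / enorm x) * x 0 j + g (enorm x) * (j == k)%:R).
  by apply: is_derive_mul; [exact: is_derive_radial|exact: is_derive_coord].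
by congr (_ + _); rewrite -!mulrA; congr (_ * _); rewrite mulrCA mulrA.
Qed.

Lemma dx_radial_coord g (dg : R) x (k j : 'I_n) : x != 0 ->
  is_derive (enorm x) 1 g dg ->
  dx k (fun y => g (enorm y) * y 0 j) x =
    dg / enorm x * (x 0 k * x 0 j) + g (enorm x) * (j == k)%:R.
Proof.
by move=> x0 gd; rewrite /dx; have D := is_derive_radial_coord k j x0 gd;
  rewrite derive_val.
Qed.

Lemma sum_coord_delta x (j : 'I_n) : \sum_(k < n) x 0 k * (j == k)%:R = x 0 j.
Proof.
rewrite (bigD1 j)//= big1 => [|k]; first by rewrite eqxx mulr1 addr0.
by rewrite eq_sym => /negbTE ->; rewrite mulr0.
Qed.

(** The gradient is a multiple of [x 0 k * x 0 j] plus a multiple of the identity. Contracted with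
    [x], the first part produces [enorm x ^+ 2] and the second returns [x] itself. *)
Lemma advection_radial g (dg : R) x : x != 0 -> is_derive (enorm x) 1 g dg ->
  advection (fun y => g (enorm y) *: y) x =
    (g (enorm x) * (dg * enorm x + g (enorm x))) *: x.
Proof.
move=> x0 gd; have r0 : enorm x != 0 by rewrite gt_eqF// enorm_gt0.
apply/rowP => j; rewrite !mxE.
have E k : (g (enorm x) *: x) 0 k * dx k (fun y => (g (enorm y) *: y) 0 j) x =
    g (enorm x) * dg / enorm x * x 0 j * x 0 k ^+ 2 +
    g (enorm x) ^+ 2 * (x 0 k * (j == k)%:R).
  rewrite (_ : (fun y => (g (enorm y) *: y) 0 j) = (fun y => g (enorm y) * y 0 j));
    last by apply/funext => y; rewrite mxE.
  by rewrite (dx_radial_coord _ _ x0 gd) mxE; ring.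
under eq_bigr do rewrite E.
rewrite big_split/= -!mulr_sumr -enorm_sqr sum_coord_delta.
by field.
Qed.

Lemma divergence_radial g (dg : R) x : x != 0 -> is_derive (enorm x) 1 g dg ->
  divergence (fun y => g (enorm y) *: y) x =
    enorm x * dg + n%:R * g (enorm x).
Proof.
move=> x0 gd; have r0 : enorm x != 0 by rewrite gt_eqF// enorm_gt0.
have E k : dx k (fun y => (g (enorm y) *: y) 0 k) x =
    dg / enorm x * x 0 k ^+ 2 + g (enorm x).
  rewrite (_ : (fun y => (g (enorm y) *: y) 0 k) = (fun y => g (enorm y) * y 0 k));
    last by apply/funext => y; rewrite mxE.
  by rewrite (dx_radial_coord _ _ x0 gd) eqxx mulr1.
rewrite /divergence; under eq_bigr do rewrite E.
rewrite big_split/= -mulr_sumr -enorm_sqr sumr_const card_ord -mulr_natl.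
by congr (_ + _); field.
Qed.

Section SecondOrder.
Variables (g h : R -> R).
Hypothesis gd : forall s : R, 0 < s -> is_derive s 1 g (s * h s).

(** Writing the derivative of [g] as [s * h s] removes the division by [enorm y] from the first
    derivative, which is then differentiated by the product rule. The coefficient 2 collects one
    term from [y 0 k * y 0 j] and one from [g (enorm y)]. *)
Lemma is_derive_dx_radial_coord (dh : R) x (k j : 'I_n) : x != 0 ->
  is_derive (enorm x) 1 h dh ->
  is_derive x (evec k) (dx k (fun y => g (enorm y) * y 0 j))
    (dh / enorm x * x 0 j * x 0 k ^+ 2
     + h (enorm x) * x 0 j + 2 * h (enorm x) * (x 0 k * (j == k)%:R)).
Proof.
move=> x0 hd; have r0 : enorm x != 0 by rewrite gt_eqF// enorm_gt0.
apply: (@near_eq_is_derive _ _ _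
    (fun y => h (enorm y) * (y 0 k * y 0 j) + g (enorm y) * (j == k)%:R)).
  near=> y; have y0 : y != 0 by near: y; exact: near_neq0.
  have s0 := enorm_gt0 y0.
  rewrite (dx_radial_coord _ _ y0 (gd s0)); congr (_ * _ + _).
  by rewrite mulrAC mulfV ?mul1r// gt_eqF.
have D := is_derive_add
  (is_derive_mul (is_derive_radial k x0 hd)
    (is_derive_mul (is_derive_coord x k k) (is_derive_coord x k j)))
  (is_derive_mul (is_derive_radial k x0 (gd (enorm_gt0 x0)))
    (is_derive_cst ((j == k)%:R : R) x (evec k))).
rewrite (_ : _ + _ + _ = dh * (x 0 k / enorm x) * (x 0 k * x 0 j) +
  h (enorm x) * ((k == k)%:R * x 0 j + x 0 k * (j == k)%:R) +
  (enorm x * h (enorm x) * (x 0 k / enorm x) * (j == k)%:R +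
    g (enorm x) * 0)) //.
by rewrite eqxx /=; field.
Unshelve. all: by end_near. Qed.

(** Summed over [k], the squares give [enorm x ^+ 2], the constant term is counted [n] times, and
    the Kronecker term survives only at [k = j], which accounts for [n%:R + 2]. *)
Lemma laplacian_radial_coord (dh : R) x (j : 'I_n) : x != 0 ->
  is_derive (enorm x) 1 h dh ->
  laplacian (fun y => g (enorm y) * y 0 j) x =
    (enorm x * dh + (n%:R + 2) * h (enorm x)) * x 0 j.
Proof.
move=> x0 hd; have r0 : enorm x != 0 by rewrite gt_eqF// enorm_gt0.
have E k : dx k (dx k (fun y => g (enorm y) * y 0 j)) x =
    dh / enorm x * x 0 j * x 0 k ^+ 2
     + h (enorm x) * x 0 j + 2 * h (enorm x) * (x 0 k * (j == k)%:R).
  by rewrite {1}/dx; have D := is_derive_dx_radial_coord k j x0 hd;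
    rewrite derive_val.
rewrite /laplacian; under eq_bigr do rewrite E.
rewrite !big_split/= -!mulr_sumr -enorm_sqr sum_coord_delta.
rewrite sumr_const card_ord -mulr_natl.
by field.
Qed.

End SecondOrder.

End RadialFields.

(** Dividing by [r] instead of lowering the exponent covers [m = 0] as well, and keeps [r ^+ m] as a
    common factor. *)
Lemma is_derive_pow {R : realType} (m : nat) (r : R) : r != 0 ->
  is_derive r 1 (fun s => s ^+ m) (m%:R / r * r ^+ m).
Proof.
move=> r0; have := @is_deriveX R R id m r 1 1 (is_derive_id r 1).
rewrite exprfctE /GRing.scale/= mulr1; case: m => [|m]; first by rewrite !mul0r.
by rewrite exprS mulrA divfK.
Qed.

(** * Equivalence of the system in space with the radial system *)

Section RadialEquivalence.
Context {R : realType} {n : nat}.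
Variables (eps : R) (q rho : R -> R -> R).
Hypotheses (hn : (0 < n)%N) (sq : smooth q) (srho : smooth rho).
Implicit Types (x : 'rV[R]_n) (r t : R).

Let ratio t s := q s t / s.

(* s * slope is the derivative of ratio, so the gradient of ratio(|x|) is
   slope(|x|) x. *)
Let slope t s := (s * dr q s t - q s t) / s ^+ 3.

Let u := @radial_velocity R n q.

Let d := @radial_density R n rho.

Let flux s t := s ^+ n.-1 * rho s t * q s t.

Lemma radial_velocityE x t : u x t = ratio t (enorm x) *: x.
Proof. by rewrite /u /radial_velocity scalerA. Qed.

Lemma radial_velocity_coord t (j : 'I_n) :
  (fun y => u y t 0 j) = (fun y => ratio t (enorm y) * y 0 j).
Proof. by apply/funext => y; rewrite radial_velocityE mxE. Qed.

Lemma radial_momentum_flux t :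
  (fun y => d y t *: u y t) =
  (fun y => (rho (enorm y) t * ratio t (enorm y)) *: y).
Proof. by apply/funext => y; rewrite radial_velocityE scalerA. Qed.

(** The quotient rule, put in the shape [s * h s] that the second-order formulas for radial fields
    require. *)
Lemma is_derive_ratio r t : 0 < r -> 0 < t ->
  is_derive r 1 (ratio t) (r * slope t r).
Proof.
move=> r0 t0; have rN0 : r != 0 by rewrite gt_eqF.
have D := is_derive1_div (smooth_is_derive_r sq r0 t0)
  (is_derive_id r (1 : R)) rN0.
by apply: (is_derive_eq D); rewrite /slope; field.
Qed.

Lemma is_derive_slope r t : 0 < r -> 0 < t ->
  is_derive r 1 (slope t)
    (dr (dr q) r t / r ^+ 2 - 3 * dr q r t / r ^+ 3 + 3 * q r t / r ^+ 4).
Proof.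
move=> r0 t0; have rN0 : r != 0 by rewrite gt_eqF.
have N := is_derive_sub
  (is_derive_mul (is_derive_id r (1 : R))
    (smooth_is_derive_r (smooth_dr sq) r0 t0))
  (smooth_is_derive_r sq r0 t0).
have r30 : r ^+ 3 != 0 by rewrite expf_neq0.
by apply: (is_derive_eq (is_derive1_div N (is_derive_pow 3 rN0) r30)); field.
Qed.

Lemma is_derive_flux r t : 0 < r -> 0 < t ->
  is_derive r 1 (fun s => flux s t)
    (r ^+ n.-1 * ((n%:R - 1) / r * rho r t * q r t +
       dr rho r t * q r t + rho r t * dr q r t)).
Proof.
move=> r0 t0; have rN0 : r != 0 by rewrite gt_eqF.
have D := is_derive_mul (is_derive_mul (is_derive_pow n.-1 rN0)
  (smooth_is_derive_r srho r0 t0)) (smooth_is_derive_r sq r0 t0).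
(* Since [n] is positive, the truncated predecessor [n.-1] really equals [n - 1] in [R]. *)
by apply: (is_derive_eq D); rewrite -subn1 natrB//; ring.
Qed.

Lemma vdt_radial x t : x != 0 -> 0 < t ->
  vdt u x t = (dt q (enorm x) t / enorm x) *: x.
Proof.
move=> x0 t0; apply/rowP => j; rewrite !mxE.
have D := is_derive_mul (smooth_is_derive_t sq (enorm_gt0 x0) t0)
  (is_derive_cst ((enorm x)^-1 * x 0 j : R) t (1 : R)).
rewrite (_ : (fun s => u x s 0 j) =
    (fun s => q (enorm x) s * ((enorm x)^-1 * x 0 j))).
  by rewrite (is_derive_derive1 D) mulr0 addr0 mulrA.
by apply/funext => s; rewrite /u /radial_velocity !mxE.
Qed.

Lemma vlaplacian_radial x t : x != 0 -> 0 < t ->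
  let r := enorm x in
  vlaplacian (u ^~ t) x =
    ((dr (dr q) r t + (n%:R - 1) / r * dr q r t
      - (n%:R - 1) / r ^+ 2 * q r t) / r) *: x.
Proof.
move=> x0 t0 r; have r0 := enorm_gt0 x0; have rN0 : r != 0 by rewrite gt_eqF.
apply/rowP => j; rewrite !mxE radial_velocity_coord.
rewrite (laplacian_radial_coord (fun s s0 => is_derive_ratio s0 t0) j x0
  (is_derive_slope r0 t0)).
by congr (_ * _); rewrite /slope -/r; field.
Qed.

Lemma advection_radial_velocity x t : x != 0 -> 0 < t ->
  let r := enorm x in
  advection (u ^~ t) x = (q r t * dr q r t / r) *: x.
Proof.
move=> x0 t0 r; have r0 := enorm_gt0 x0; have rN0 : r != 0 by rewrite gt_eqF.
rewrite (_ : (fun y => u y t) = (fun y => ratio t (enorm y) *: y)); last first.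
  by apply/funext => y; rewrite radial_velocityE.
rewrite (advection_radial x0 (is_derive_ratio r0 t0)).
by congr (_ *: _); rewrite /ratio /slope -/r; field.
Qed.

Lemma radial_momentumP x t : x != 0 -> 0 < t ->
  let r := enorm x in
  vdt u x t + advection (u ^~ t) x = (eps / 2) *: vlaplacian (u ^~ t) x <->
  dt q r t + q r t * dr q r t =
    eps / 2 * (dr (dr q) r t + (n%:R - 1) / r * dr q r t
               - (n%:R - 1) / r ^+ 2 * q r t).
Proof.
move=> x0 t0 r; have rN0 : r != 0 by rewrite gt_eqF// enorm_gt0.
rewrite vdt_radial// advection_radial_velocity// vlaplacian_radial//.
rewrite -/r scalerA -scalerDl mulrA -mulrDl; split=> [|->//].
(* Both sides are multiples of the nonzero vector [x], so their multipliers agree; the common factor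
   [r^-1] is then cancelled. *)
move/eqP; rewrite -subr_eq0 -scalerBl scaler_eq0 (negbTE x0) orbF subr_eq0.
by move=> /eqP; apply: mulIf; rewrite invr_eq0.
Qed.

(** The derivative of [flux] carries the factor [r ^+ n.-1], which the weight cancels; what remains
    is the divergence of a radial field. No equation is assumed. *)
Lemma radial_massE x t : x != 0 -> 0 < t ->
  let r := enorm x in
  derive1 (fun s => d x s) t + divergence (fun y => d y t *: u y t) x =
  dt rho r t + r ^- n.-1 * dr flux r t.
Proof.
move=> x0 t0 r; have r0 := enorm_gt0 x0; have rN0 : r != 0 by rewrite gt_eqF.
rewrite radial_momentum_flux; congr (_ + _).
have M := is_derive_mul (smooth_is_derive_r srho r0 t0) (is_derive_ratio r0 t0).
rewrite (divergence_radial x0 M) -/r.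
have -> : dr flux r t = _ := is_derive_derive1 (is_derive_flux r0 t0).
rewrite mulKf ?expf_neq0// /ratio /slope -/r.
by field.
Qed.

(** Smoothness of [q] and [rho] supplies all the existence clauses in the definition of
    [burgers_system]. *)
Lemma radial_velocity_derivable x t (j k : 'I_n) : x != 0 -> 0 < t ->
  [/\ derivable (fun s => u x s 0 j) t 1,
      derivable (fun y => u y t 0 j) x (evec k),
      derivable (dx k (fun y => u y t 0 j)) x (evec k)
    & derivable (fun y => d y t * u y t 0 k) x (evec k)].
Proof.
move=> x0 t0; have r0 := enorm_gt0 x0.
split.
- rewrite (_ : (fun s => u x s 0 j) =
      (fun s => q (enorm x) s * ((enorm x)^-1 * x 0 j))); last first.
    by apply/funext => s; rewrite /u /radial_velocity !mxE.
  by have [] := is_derive_mul (smooth_is_derive_t sq r0 t0)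
    (is_derive_cst ((enorm x)^-1 * x 0 j : R) t (1 : R)).
- rewrite radial_velocity_coord.
  by have [] := is_derive_radial_coord k j x0 (is_derive_ratio r0 t0).
- rewrite radial_velocity_coord.
  by have [] := is_derive_dx_radial_coord (fun s s0 => is_derive_ratio s0 t0)
    k j x0 (is_derive_slope r0 t0).
- rewrite (_ : (fun y => _) =
      (fun y => (rho (enorm y) t * ratio t (enorm y)) * y 0 k)).
    by have [] := is_derive_radial_coord k k x0
      (is_derive_mul (smooth_is_derive_r srho r0 t0) (is_derive_ratio r0 t0)).
  by apply/funext => y; rewrite radial_velocityE mxE mulrA.
Qed.

(** Every positive radius is attained by a point of space; a coordinate axis exists because [n] is
    positive. *)
Lemma enorm_axis r : 0 < r -> enorm (r *: evec (Ordinal hn)) = r.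
Proof.
move=> r0; rewrite /enorm (bigD1 (Ordinal hn))//= big1 => [|k /negbTE k0].
  by rewrite addr0 !mxE !eqxx/= mulr1 sqrtr_sqr gtr0_norm.
by rewrite !mxE k0 andbF mulr0 expr0n.
Qed.

Lemma burgers_radialP : burgers_system eps u d <-> radial_system n eps q rho.
Proof.
split=> [B r t r0 t0 /=|S x t x0 t0].
  (* One point on the sphere of radius [r] suffices to recover the scalar equations at [r]. *)
  pose x : 'rV[R]_n := r *: evec (Ordinal hn).
  have xr : enorm x = r by exact: enorm_axis.
  have x0 : x != 0.
    apply: contraTneq r0 => x0; rewrite -xr x0 /enorm big1 ?sqrtr0 ?ltxx//.
    by move=> k _; rewrite mxE expr0n.
  have [_ /(radial_momentumP x0 t0)] := B x t x0 t0.
  rewrite xr => mom _; rewrite radial_massE// xr => mass.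
  split=> //.
  - split; first by case: (smooth_is_derive_t sq r0 t0).
      by move=> s s0; case: (smooth_is_derive_r sq s0 t0).
    by case: (smooth_is_derive_r (smooth_dr sq) r0 t0).
  - by split; [case: (smooth_is_derive_t srho r0 t0)|case: (is_derive_flux r0 t0)].
have r0 := enorm_gt0 x0; have [_ mom _ mass] := S _ _ r0 t0.
split.
- move=> j; split; first by have [] := radial_velocity_derivable j j x0 t0.
  move=> k; split; last by have [] := radial_velocity_derivable j k x0 t0.
  by move=> y y0; have [] := radial_velocity_derivable j k y0 t0.
- exact/radial_momentumP.
- split; first by case: (smooth_is_derive_t srho r0 t0).
  by move=> k; have [] := radial_velocity_derivable k k x0 t0.
- by rewrite radial_massE.
Qed.

End RadialEquivalence.

(** * Linearization by the Hopf-Cole transformation *)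

Section HopfCole.
Context {R : realType}.
Variables (n : nat) (eps : R) (a p : R -> R -> R).
Hypotheses (sa : smooth a) (sp : smooth p).
Hypothesis a_gt0 : forall r t, 0 < r -> 0 < t -> 0 < a r t.
Implicit Types r t : R.

Let q := hopf_cole_velocity eps a.

Lemma is_derive_r_hopf_cole r t : 0 < r -> 0 < t ->
  is_derive r 1 (fun s => q s t)
    (- eps * (dr (dr a) r t / a r t - dr a r t * dr a r t / a r t ^+ 2)).
Proof.
move=> r0 t0; apply: is_derive_scale; apply: is_derive1_div.
- exact: smooth_is_derive_r (smooth_dr sa) _ _.
- exact: smooth_is_derive_r.
- by rewrite gt_eqF// a_gt0.
Qed.

Lemma dr_hopf_cole r t : 0 < r -> 0 < t ->
  dr q r t =
    - eps * (dr (dr a) r t / a r t - dr a r t * dr a r t / a r t ^+ 2).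
Proof. by move=> r0 t0; exact/is_derive_derive1/is_derive_r_hopf_cole. Qed.

Lemma is_derive_r_dr_hopf_cole r t : 0 < r -> 0 < t ->
  let a0 := a r t in let a1 := dr a r t in
  let a2 := dr (dr a) r t in let a3 := dr (dr (dr a)) r t in
  is_derive r 1 (fun s => dr q s t)
    (- eps * (a3 / a0 - 3 * a1 * a2 / a0 ^+ 2 + 2 * a1 ^+ 3 / a0 ^+ 3)).
Proof.
move=> r0 t0 a0 a1 a2 a3; have aN0 : a0 != 0 by rewrite gt_eqF// a_gt0.
have D0 : is_derive r 1 (fun s => a s t) a1 := smooth_is_derive_r sa r0 t0.
have D1 : is_derive r 1 (fun s => dr a s t) a2 :=
  smooth_is_derive_r (smooth_dr sa) r0 t0.
have D2 : is_derive r 1 (fun s => dr (dr a) s t) a3 :=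
  smooth_is_derive_r (smooth_dr (smooth_dr sa)) r0 t0.
have aa0 : a0 * a0 != 0 by rewrite mulf_neq0.
have D := is_derive_scale (- eps) (is_derive_sub (is_derive1_div D2 D0 aN0)
  (is_derive1_div (is_derive_mul D1 D1) (is_derive_mul D0 D0) aa0)).
(* The second derivative is computed from the explicit formula for [dr q], valid at all positive
   radii. *)
have E s (s0 : 0 < s) := esym (dr_hopf_cole s0 t0).
apply: (eq_pos_is_derive r0 E (is_derive_eq D _)); rewrite -/a0 -/a1 -/a2.
by clear -aN0; clearbody a0 a1 a2 a3; field.
Qed.

Lemma is_derive_t_hopf_cole r t : 0 < r -> 0 < t ->
  is_derive t 1 (fun s => q r s)
    (- eps * (dt (dr a) r t / a r t - dr a r t * dt a r t / a r t ^+ 2)).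
Proof.
move=> r0 t0; apply: is_derive_scale; apply: is_derive1_div.
- exact: smooth_is_derive_t (smooth_dr sa) _ _.
- exact: smooth_is_derive_t.
- by rewrite gt_eqF// a_gt0.
Qed.

Hypothesis heat : radial_heat n eps a.

(** The heat equation holds at all positive radii, so it may be differentiated in [r].
    Differentiating [1 / r] creates the last term, the source of the zeroth-order term in the
    equation for [q]. *)
Lemma dr_dt_heat r t : 0 < r -> 0 < t ->
  dr (dt a) r t = eps / 2 * (dr (dr (dr a)) r t +
    (n%:R - 1) / r * dr (dr a) r t - (n%:R - 1) / r ^+ 2 * dr a r t).
Proof.
move=> r0 t0; have rN0 : r != 0 by rewrite gt_eqF.
have D1 := smooth_is_derive_r (smooth_dr sa) r0 t0.
have D2 := smooth_is_derive_r (smooth_dr (smooth_dr sa)) r0 t0.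
have D := is_derive_scale (eps / 2) (is_derive_add D2
  (is_derive_mul (is_derive1_div (is_derive_cst (n%:R - 1 : R) r (1 : R))
    (is_derive_id r (1 : R)) rN0) D1)).
apply: is_derive_derive1.
have E s (s0 : 0 < s) := esym (heat s0 t0).
apply: (eq_pos_is_derive r0 E (is_derive_eq D _)); rewrite /cst; move: (dr (dr (dr a)) r t) (dr (dr a) r t) (dr a r t) => x y z.
by field.
Qed.

Hypothesis trans : transport p q.

Lemma hopf_cole_radial : radial_system n eps q (hopf_cole_density n p).
Proof.
move=> r t r0 t0 /=; have rN0 : r != 0 by rewrite gt_eqF.
have aN0 : a r t != 0 by rewrite gt_eqF// a_gt0.
have T := is_derive_t_hopf_cole r0 t0.
have RR := is_derive_r_dr_hopf_cole r0 t0.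
have Rho : is_derive t 1 (fun s => hopf_cole_density n p r s)
    (r ^- n.-1 * dt p r t).
  by apply: is_derive_scale; exact: smooth_is_derive_t.
(* For positive [s] the powers of [s] cancel, so the weighted flux is just [p * q]. *)
have Flux : is_derive r 1 (fun s => s ^+ n.-1 * hopf_cole_density n p s t * q s t)
    (dr (fun s t => p s t * q s t) r t).
  have D := is_derive_mul (smooth_is_derive_r sp r0 t0)
    (is_derive_r_hopf_cole r0 t0).
  have -> : dr (fun s t => p s t * q s t) r t = _ := is_derive_derive1 D.
  apply: (eq_pos_is_derive r0) D => s s0.
  by rewrite /hopf_cole_density mulVKf// expf_neq0// gt_eqF.
split.
- split; first by case: T.
    by move=> s s0; case: (is_derive_r_hopf_cole s0 t0).
  by case: RR.
- rewrite {1}/dt (is_derive_derive1 T) dr_hopf_cole//.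
  have -> : dr (dr q) r t = _ := is_derive_derive1 RR.
  (* These rewrites eliminate every time derivative of [a]. *)
  rewrite dt_dr// dr_dt_heat// heat//.
  rewrite /q /hopf_cole_velocity.
  move: aN0; move: (dr (dr (dr a)) r t) (dr (dr a) r t) (dr a r t) (a r t).
  by move=> a3 a2 a1 a0 aN0; field; rewrite aN0 rN0.
- by split; [case: Rho|case: Flux].
- have -> : dt (hopf_cole_density n p) r t = _ := is_derive_derive1 Rho.
  (* The mass equation is [r ^- n.-1] times the transport equation. *)
  by rewrite [X in _ + _ * X](is_derive_derive1 Flux) -mulrDr trans// mulr0.
Qed.

End HopfCole.

Unset Implicit Arguments.

Theorem theorem2p1 (R : realType) (n : nat) (eps : R)
    (hn : (1 <= n)%N) (heps : 0 < eps) :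
  (forall q rho : R -> R -> R, smooth q -> smooth rho ->
     burgers_system eps (@radial_velocity R n q) (@radial_density R n rho)
       <-> radial_system n eps q rho)
  /\
  (forall a p : R -> R -> R, smooth a -> smooth p ->
     (forall r t, 0 < r -> 0 < t -> 0 < a r t) ->
     radial_heat n eps a ->
     transport p (hopf_cole_velocity eps a) ->
     radial_system n eps (hopf_cole_velocity eps a) (hopf_cole_density n p)).
Proof.
split=> [q rho sq srho|a p sa sp a_gt0 heat trans].
  exact: burgers_radialP.
exact: hopf_cole_radial.
Qed.
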